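(* Let $0<\alpha,\beta<1$, $n\in\mathbb{N}$, and let $j,k\in\mathbb{N}$ with $j,k\le n$. If $j\ne k$, then $$[\varphi_j^+,u_k^+]_n(1)=[\varphi_j^-,u_k^-]_n(-1)=0.$$ Additionally, $$[\varphi_k^+,u_k^+]_n(1)=[\varphi_k^-,u_k^-]_n(-1)=1.$$
   Context: Fix $0<\alpha,\beta<1$ and $n\in\mathbb{N}$. Let $L^2_{\alpha,\beta}:=L^2\big((-1,1),(1-x)^\alpha(1+x)^\beta dx\big)$. The Jacobi expression is $\ell[f](x)=-\frac{1}{(1-x)^{\alpha}(1+x)^{\beta}}\big[(1-x)^{\alpha+1}(1+x)^{\beta+1}f'(x)\big]'$, and $\ell^n$ is its $n$-fold composition. It can be written as $\ell^n[f]=\frac{1}{(1-x)^{\alpha}(1+x)^{\beta}}\sum_{k=1}^n(-1)^k\big[a_kf^{(k)}\big]^{(k)}$ with $a_k(x)=C(n,k,\alpha,\beta)(1-x)^{\alpha+k}(1+x)^{\beta+k}$, where the real constants $C(n,k,\alpha,\beta)$ are determined by this identity. Maximal domain: $\mathcal{D}_{\max}^{n}=\{f\in L^2_{\alpha,\beta}: f,f',\dots,f^{(2n-1)}\in AC_{\rm loc}(-1,1),\ \ell^n[f]\in L^2_{\alpha,\beta}\}$. Sesquilinear form: for $f,g\in\mathcal{D}^n_{\max}$ and $x\in(-1,1)$, $$[f,g]_n(x)=\sum_{k=1}^n\sum_{j=1}^k(-1)^{k+j}\Big\{\big[a_k\overline{g}^{(k)}\big]^{(k-j)}(x)f^{(j-1)}(x)-\big[a_kf^{(k)}\big]^{(k-j)}(x)\overline{g}^{(j-1)}(x)\Big\},$$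 and $[f,g]_n(\pm1):=\lim_{x\to\pm1^{\mp}}[f,g]_n(x)$; these limits exist and are finite. For $1\le j\le n$ fix $C^\infty(-1,1)$ functions $\varphi_j^{\pm}$ and $v_j^\pm$ with: $\varphi_j^+(x)=(1-x)^{j-1}$ and $v_j^+(x)=(1-x)^{-\alpha+n-j}$ for $x$ near $1$, both $0$ for $x$ near $-1$; $\varphi_j^-(x)=(1+x)^{j-1}$ and $v_j^-(x)=(1+x)^{-\beta+n-j}$ for $x$ near $-1$, both $0$ for $x$ near $1$. All of these belong to $\mathcal{D}_{\max}^n$. Define recursively, for $k=1,\dots,n$, $$u_k^{\pm}:=\Big\{v_k^{\pm}-\sum_{j=1}^{k-1}\frac{[\varphi_j^{\pm},v_k^{\pm}]_n(\pm1)}{[\varphi_j^{\pm},u_j^{\pm}]_n(\pm1)}u_j^{\pm}\Big\}\Big/[\varphi_k^{\pm},v_k^{\pm}]_n(\pm1)$$ (the denominators are nonzero). *)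

(* Defs.v *)
From Stdlib Require Import Reals.
From Coquelicot Require Import Coquelicot.

Local Open Scope R_scope.

(* Complex-valued functions on the open interval (-1,1) are represented by
   total functions R -> C; only their values on (-1,1) ever matter. *)

(* k-th derivative of a complex-valued function of a real variable. *)
Definition CDerive_n (f : R -> C) (k : nat) (x : R) : C :=
  (Derive_n (fun t => Re (f t)) k x, Derive_n (fun t => Im (f t)) k x).

Definition smooth_on_m11 (f : R -> C) : Prop :=
  forall (m : nat) (x : R), -1 < x < 1 ->
    ex_derive_n (fun t => Re (f t)) m x /\ ex_derive_n (fun t => Im (f t)) m x.

Definition jacobi_weight (alpha beta x : R) : R :=
  Rpower (1 - x) alpha * Rpower (1 + x) beta.

Definition jacobi_expr (alpha beta : R) (f : R -> C) (x : R) : C :=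
  (- (RtoC (/ jacobi_weight alpha beta x) *
      CDerive_n (fun t =>
        RtoC (jacobi_weight (alpha + 1) (beta + 1) t) * CDerive_n f 1 t)%C 1 x))%C.

(* In the sequel [c k] stands for the constant C(n,k,alpha,beta). *)
Definition jacobi_a (alpha beta : R) (c : nat -> R) (k : nat) (x : R) : R :=
  c k * jacobi_weight (alpha + INR k) (beta + INR k) x.

(* The identity that determines c 1, ..., c n. *)
Definition lagrange_coefficients (n : nat) (alpha beta : R) (c : nat -> R) : Prop :=
  forall f : R -> C, smooth_on_m11 f ->
  forall x : R, -1 < x < 1 ->
    Nat.iter n (jacobi_expr alpha beta) f x =
    (RtoC (/ jacobi_weight alpha beta x) *
     sum_n_m (fun k : nat =>
       RtoC ((-1) ^ k) *
       CDerive_n (fun t =>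
         RtoC (jacobi_a alpha beta c k t) * CDerive_n f k t) k x) 1 n)%C.

Definition sesq_form (n : nat) (alpha beta : R) (c : nat -> R)
    (f g : R -> C) (x : R) : C :=
  let a := jacobi_a alpha beta c in
  let gbar := fun t => Cconj (g t) in
  sum_n_m (fun k : nat =>
    sum_n_m (fun j : nat =>
      RtoC ((-1) ^ (k + j)) *
      (CDerive_n (fun t => RtoC (a k t) * CDerive_n gbar k t) (k - j) x
         * CDerive_n f (j - 1) x
       - CDerive_n (fun t => RtoC (a k t) * CDerive_n f k t) (k - j) x
         * CDerive_n gbar (j - 1) x))%C 1 k) 1 n.

(* F is [at_left 1] for the endpoint 1 and [at_right (-1)] for the endpoint -1. *)
Definition is_sesq_form_lim (n : nat) (alpha beta : R) (c : nat -> R)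
    (F : (R -> Prop) -> Prop) (f g : R -> C) (l : C) : Prop :=
  filterlim (sesq_form n alpha beta c f g) F (locally l).

(* The value of the limit; meaningful only when the limit exists. *)
Definition sesq_form_lim (n : nat) (alpha beta : R) (c : nat -> R)
    (F : (R -> Prop) -> Prop) (f g : R -> C) : C :=
  iota (T := C_R_CompleteNormedModule) (is_sesq_form_lim n alpha beta c F f g).

(* On each side the families are indexed by 1 <= j <= n. *)
Definition families_plus (n : nat) (alpha : R) (phi v : nat -> R -> C) : Prop :=
  forall j : nat, (1 <= j <= n)%nat ->
    smooth_on_m11 (phi j) /\ smooth_on_m11 (v j) /\
    at_left 1 (fun x => phi j x = RtoC ((1 - x) ^ (j - 1))) /\
    at_left 1 (fun x => v j x = RtoC (Rpower (1 - x) (- alpha + INR n - INR j))) /\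
    at_right (-1) (fun x => phi j x = RtoC 0 /\ v j x = RtoC 0).

Definition families_minus (n : nat) (beta : R) (phi v : nat -> R -> C) : Prop :=
  forall j : nat, (1 <= j <= n)%nat ->
    smooth_on_m11 (phi j) /\ smooth_on_m11 (v j) /\
    at_right (-1) (fun x => phi j x = RtoC ((1 + x) ^ (j - 1))) /\
    at_right (-1) (fun x => v j x = RtoC (Rpower (1 + x) (- beta + INR n - INR j))) /\
    at_left 1 (fun x => phi j x = RtoC 0 /\ v j x = RtoC 0).

(* br f g stands for the boundary value [f,g]_n at the endpoint under
   consideration. The equation for k only involves u j with j < k, so it
   determines u 1, ..., u n on (-1,1). *)
Definition recursive_family (n : nat) (br : (R -> C) -> (R -> C) -> C)
    (phi v u : nat -> R -> C) : Prop :=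
  forall k : nat, (1 <= k <= n)%nat ->
  forall x : R, -1 < x < 1 ->
    u k x =
    ((v k x
      - sum_n_m (fun j : nat =>
          br (phi j) (v k) / br (phi j) (u j) * u j x) 1 (k - 1))
     / br (phi k) (v k))%C.

(* Main.v *)
(* Put [t = 1 - x] near the endpoint [1] (and [t = 1 + x] near [-1]). There
   [phi_j = t^(j-1)] and [v_k = t^(n-k-alpha)], so each summand of [[phi_j, v_k]]
   is a product of powers of [t] and of a derivative of [t^p (2-t)^q]. The
   summands in which [a_m] multiplies a derivative of [phi_j] are
   [O(t^(n-k+j-m))] with [m <= j-1] and vanish in the limit. In the others
   [a_m v_k^(m)] is a multiple of [t^(n-k) (2-t)^(beta+m)], which is smooth up to
   [t = 0]: the limit exists, is [0] for [j > k], and for [j = k] comes from the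
   single summand [m = n], a nonzero multiple of [c n]. Thus the matrix
   [[phi_j, v_k]] is triangular with nonzero diagonal, and the recursion for
   [u_k] is Gram-Schmidt orthogonalisation against it. *)
Require Import Defs.
From Stdlib Require Import Reals Lra Lia.
From Coquelicot Require Import Coquelicot.

Local Open Scope R_scope.

(** * Limits and one-term reductions of finite sums *)

Lemma filterlim_locally_eq {T : Type} {F : (T -> Prop) -> Prop}
    (f : T -> R) (a b : R) :
  a = b -> filterlim f F (locally a) -> filterlim f F (locally b).
Proof. now intros ->. Qed.

Lemma filterlim_Rplus {T : Type} {F : (T -> Prop) -> Prop} {FF : Filter F}
    (f g : T -> R) (a b : R) :
  filterlim f F (locally a) -> filterlim g F (locally b) ->
  filterlim (fun x => f x + g x) F (locally (a + b)).
Proof.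
intros Hf Hg.
eapply filterlim_comp_2; [exact Hf | exact Hg |].
exact (filterlim_plus (V := R_NormedModule) a b).
Qed.

Lemma filterlim_Rmult {T : Type} {F : (T -> Prop) -> Prop} {FF : Filter F}
    (f g : T -> R) (a b : R) :
  filterlim f F (locally a) -> filterlim g F (locally b) ->
  filterlim (fun x => f x * g x) F (locally (a * b)).
Proof.
intros Hf Hg.
eapply filterlim_comp_2; [exact Hf | exact Hg |].
exact (filterlim_mult (K := R_AbsRing) a b).
Qed.

Lemma filterlim_Rscal {T : Type} {F : (T -> Prop) -> Prop} {FF : Filter F}
    (k : R) (f : T -> R) (a : R) :
  filterlim f F (locally a) -> filterlim (fun x => k * f x) F (locally (k * a)).
Proof.
intros Hf.
exact (filterlim_Rmult _ _ _ _ (filterlim_const k) Hf).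
Qed.

Lemma filterlim_sum_n_m {T : Type} {F : (T -> Prop) -> Prop} {FF : Filter F}
    (f : nat -> T -> R) (l : nat -> R) (a b : nat) :
  (forall k, (a <= k <= b)%nat -> filterlim (f k) F (locally (l k))) ->
  filterlim (fun x => sum_n_m (fun k => f k x) a b) F (locally (sum_n_m l a b)).
Proof.
induction b as [|b IH]; intros H.
- destruct a as [|a].
  + rewrite sum_n_n.
    apply (filterlim_ext (f 0%nat)); [intros x; now rewrite sum_n_n|].
    apply H; lia.
  + rewrite sum_n_m_zero by lia.
    apply (filterlim_ext (fun _ => 0)); [intros x; now rewrite sum_n_m_zero by lia|].
    apply filterlim_const.
- destruct (Compare_dec.le_lt_dec a (S b)) as [Hab|Hab].
  + rewrite sum_n_Sm by exact Hab.
    apply (filterlim_ext (fun x => sum_n_m (fun k => f k x) a b + f (S b) x)).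
    * intros x; now rewrite sum_n_Sm by exact Hab.
    * apply filterlim_Rplus; [apply IH; intros; apply H; lia | apply H; lia].
  + rewrite sum_n_m_zero by lia.
    apply (filterlim_ext (fun _ => 0)); [intros x; now rewrite sum_n_m_zero by lia|].
    apply filterlim_const.
Qed.

Lemma sum_n_m_eq0 (f : nat -> R) (a b : nat) :
  (forall k, (a <= k <= b)%nat -> f k = 0) -> sum_n_m f a b = 0.
Proof.
intros H.
rewrite (sum_n_m_ext_loc f (fun _ => zero)) by exact H.
apply (sum_n_m_const_zero (G := R_AbelianMonoid)).
Qed.

Lemma sum_n_m_single (f : nat -> R) (a j b : nat) :
  (a <= j <= b)%nat ->
  (forall k, (a <= k <= b)%nat -> k <> j -> f k = 0) -> sum_n_m f a b = f j.
Proof.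
intros Hj H.
rewrite (sum_n_m_Chasles f a j b) by lia.
rewrite (sum_n_m_eq0 f (S j) b) by (intros; apply H; lia).
destruct j as [|j].
- replace a with 0%nat by lia. rewrite sum_n_n. apply Rplus_0_r.
- rewrite sum_n_Sm by lia.
  rewrite (sum_n_m_eq0 f a j) by (intros; apply H; lia).
  unfold plus; simpl; ring.
Qed.

(** * Derivatives of [t^p (2-t)^q] and their behaviour as [t] tends to 0 *)

(** The factor [p] is split off first and [p - 1] passed on, in step with the recursion of
    [dpow]. *)
Fixpoint falling (p : R) (m : nat) : R :=
  match m with
  | O => 1
  | S m => p * falling (p - 1) m
  end.

Lemma falling_neq0 (p : R) (m : nat) :
  (forall i, (i < m)%nat -> p <> INR i) -> falling p m <> 0.
Proof.
revert p; induction m as [|m IH]; intros p H; simpl; [lra|].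
apply Rmult_integral_contrapositive_currified.
- apply (H 0%nat); lia.
- apply IH; intros i Hi E. apply (H (S i)); [lia|]. rewrite S_INR; lra.
Qed.

Lemma falling_INR_eq0 (N m : nat) : (N < m)%nat -> falling (INR N) m = 0.
Proof.
revert N; induction m as [|m IH]; intros N H; [lia|].
destruct N as [|N]; cbn [falling].
- simpl; ring.
- rewrite S_INR. replace (INR N + 1 - 1) with (INR N) by ring.
  rewrite IH by lia. ring.
Qed.

(* The [m]-th derivative of [t^p (2-t)^q]. *)
Fixpoint dpow (m : nat) (p q t : R) : R :=
  match m with
  | O => Rpower t p * Rpower (2 - t) q
  | S m => p * dpow m (p - 1) q t - q * dpow m p (q - 1) t
  end.

Lemma Rpower_pred (t p : R) : 0 < t -> Rpower t (p - 1) = Rpower t p / t.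
Proof.
intros Ht. unfold Rminus. rewrite Rpower_plus, Rpower_Ropp, Rpower_1 by exact Ht.
reflexivity.
Qed.

(** The recursion of [dpow] performs the innermost differentiation first, so only [m = 0] needs
    calculus; the induction must range over all [p] and [q]. *)
Lemma is_derive_dpow (m : nat) (p q t : R) :
  0 < t < 2 -> is_derive (dpow m p q) t (dpow (S m) p q t).
Proof.
intros Ht; revert p q; induction m as [|m IH]; intros p q.
- simpl. rewrite !Rpower_pred by lra. unfold Rpower.
  auto_derive; [lra | unfold Rminus; field; lra].
- apply is_derive_ext with (fun t => minus (p * dpow m (p - 1) q t) (q * dpow m p (q - 1) t)).
  { reflexivity. }
  exact (is_derive_minus _ _ _ _ _ (is_derive_scal _ _ p _ (IH _ _))
           (is_derive_scal _ _ q _ (IH _ _))).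
Qed.

Lemma dpow_0 (m : nat) (p t : R) :
  t < 2 -> dpow m p 0 t = falling p m * Rpower t (p - INR m).
Proof.
intros Ht; revert p; induction m as [|m IH]; intros p; cbn [dpow]; cbn [falling].
- rewrite Rpower_O by lra. simpl. rewrite Rminus_0_r. ring.
- rewrite IH, S_INR. replace (p - 1 - INR m) with (p - (INR m + 1)) by ring. ring.
Qed.

Lemma at_right_0_lt (e : R) : 0 < e -> at_right 0 (fun t => 0 < t < e).
Proof.
intros He. exists (mkposreal e He). intros t Ht H0.
unfold ball in Ht; simpl in Ht; unfold AbsRing_ball, abs, minus, plus, opp in Ht; simpl in Ht.
apply Rabs_def2 in Ht. lra.
Qed.

Lemma filterlim_Rpower_0 (r : R) :
  0 < r -> filterlim (fun t => Rpower t r) (at_right 0) (locally 0).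
Proof.
intros Hr. apply (filterlim_locally (U := R_UniformSpace)). intros [e He].
apply (filter_imp (fun t => 0 < t < Rpower e (/ r))).
- intros t [H0 Ht].
  assert (H1 : Rpower t r < e).
  { replace e with (Rpower (Rpower e (/ r)) r).
    - now apply Rlt_Rpower_l.
    - rewrite Rpower_mult, Rinv_l, Rpower_1; [reflexivity | exact He | lra]. }
  assert (H2 : 0 < Rpower t r) by apply exp_pos.
  unfold ball; simpl; unfold AbsRing_ball, abs, minus, plus, opp; simpl.
  apply Rabs_def1; lra.
- apply at_right_0_lt, exp_pos.
Qed.

Lemma filterlim_Rpower_2 (q : R) :
  filterlim (fun t => Rpower (2 - t) q) (at_right 0) (locally (Rpower 2 q)).
Proof.
replace (Rpower 2 q) with (Rpower (2 - 0) q) by (f_equal; ring).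
apply (filterlim_filter_le_1 (F := locally 0) (G := at_right 0) (H := locally (Rpower (2 - 0) q)) (fun t => Rpower (2 - t) q)).
- apply filter_le_within.
- apply (ex_derive_continuous (V := R_NormedModule) (fun t => Rpower (2 - t) q)).
  unfold Rpower. auto_derive. lra.
Qed.

(** Each term of the derivative carries a power of [t] with exponent at least [p - m]; multiplied by
    [t^r], all exponents are positive. *)
Lemma dpow_lim_0 (m : nat) (r p q : R) :
  0 < r + p - INR m ->
  filterlim (fun t => Rpower t r * dpow m p q t) (at_right 0) (locally 0).
Proof.
revert p q; induction m as [|m IH]; intros p q H; cbn [dpow].
- apply (filterlim_ext (fun t => Rpower t (r + p) * Rpower (2 - t) q)).
  { intros t. rewrite Rpower_plus. ring. }
  apply (filterlim_locally_eq _ (0 * Rpower 2 q)); [ring|].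
  apply filterlim_Rmult; [|apply filterlim_Rpower_2].
  apply filterlim_Rpower_0. simpl in H; lra.
- rewrite S_INR in H.
  apply (filterlim_ext (fun t => p * (Rpower t r * dpow m (p - 1) q t)
                                 + - q * (Rpower t r * dpow m p (q - 1) t))).
  { intros t. ring. }
  apply (filterlim_locally_eq _ (p * 0 + - q * 0)); [ring|].
  apply filterlim_Rplus; apply filterlim_Rscal; apply IH; lra.
Qed.

(** Only the term in which all [m] differentiations hit [t^p] keeps exponent 0; every other term
    falls under [dpow_lim_0]. *)
Lemma dpow_lim_critical (m : nat) (r p q : R) :
  r + p - INR m = 0 ->
  filterlim (fun t => Rpower t r * dpow m p q t) (at_right 0)
    (locally (falling p m * Rpower 2 q)).
Proof.
revert p q; induction m as [|m IH]; intros p q H; cbn [dpow]; cbn [falling].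
- rewrite Rmult_1_l.
  apply (filterlim_ext_loc (fun t => Rpower (2 - t) q)); [|apply filterlim_Rpower_2].
  apply (filter_imp (fun t => 0 < t < 1)); [|apply at_right_0_lt; lra].
  intros t Ht. rewrite <- Rmult_assoc, <- Rpower_plus.
  simpl in H. replace (r + p) with 0 by lra. rewrite Rpower_O by lra. ring.
- rewrite S_INR in H.
  apply (filterlim_ext (fun t => p * (Rpower t r * dpow m (p - 1) q t)
                                 + - q * (Rpower t r * dpow m p (q - 1) t))).
  { intros t. ring. }
  replace (p * falling (p - 1) m * Rpower 2 q)
    with (p * (falling (p - 1) m * Rpower 2 q) + - q * 0) by ring.
  apply filterlim_Rplus; apply filterlim_Rscal; [apply IH; lra|].
  apply dpow_lim_0; lra.
Qed.

(* The value at [t = 0] of the [m]-th derivative of [t^N (2-t)^q]. *)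
Fixpoint dpow_at0 (m N : nat) (q : R) : R :=
  match m with
  | O => match N with O => Rpower 2 q | S _ => 0 end
  | S m => INR N * dpow_at0 m (N - 1) q - q * dpow_at0 m N (q - 1)
  end.

Lemma dpow_at0_lim (m N : nat) (q : R) :
  filterlim (dpow m (INR N) q) (at_right 0) (locally (dpow_at0 m N q)).
Proof.
revert N q; induction m as [|m IH]; intros N q.
(* The factor [Rpower t 0], equal to 1 for [t > 0], brings the base case into the shape of the two
   preceding limits. *)
- assert (E : at_right 0 (fun t => Rpower t 0 * dpow 0 (INR N) q t = dpow 0 (INR N) q t)).
  { apply (filter_imp (fun t => 0 < t < 1)); [|apply at_right_0_lt; lra].
    intros t Ht. rewrite Rpower_O by lra. ring. }
  apply (filterlim_ext_loc _ _ E).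
  destruct N as [|N]; cbn [dpow_at0].
  + replace (Rpower 2 q) with (falling (INR 0) 0 * Rpower 2 q) by (simpl; ring).
    apply dpow_lim_critical. simpl; ring.
  + apply dpow_lim_0. rewrite S_INR. simpl. pose proof (pos_INR N). lra.
- cbn [dpow]; cbn [dpow_at0].
  apply (filterlim_ext (fun t => INR N * dpow m (INR N - 1) q t
                                 + - q * dpow m (INR N) (q - 1) t)).
  { intros t; ring. }
  replace (INR N * dpow_at0 m (N - 1) q - q * dpow_at0 m N (q - 1))
    with (INR N * dpow_at0 m (N - 1) q + - q * dpow_at0 m N (q - 1)) by ring.
  apply filterlim_Rplus; [|apply filterlim_Rscal, IH].
  (* For [N = 0] the exponent -1 arises with coefficient 0, so the truncated [N - 1] in [dpow_at0]
     does no harm. *)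
  destruct N as [|N].
  + simpl INR. apply (filterlim_ext (fun _ => 0)); [intros t; ring|].
    rewrite Rmult_0_l. apply filterlim_const.
  + apply filterlim_Rscal. replace (INR (S N) - 1) with (INR (S N - 1)); [apply IH|].
    rewrite minus_INR by lia. reflexivity.
Qed.

(** The factor [t^N] has a zero of order [N]. *)
Lemma dpow_at0_lt (m N : nat) (q : R) : (m < N)%nat -> dpow_at0 m N q = 0.
Proof.
revert N q; induction m as [|m IH]; intros N q H; simpl.
- destruct N; [lia|reflexivity].
- rewrite !IH by lia. ring.
Qed.

(** The value is [m! 2^q]: every differentiation has to fall on [t^m]. *)
Lemma dpow_at0_diag (m : nat) (q : R) : dpow_at0 m m q <> 0.
Proof.
revert q; induction m as [|m IH]; intros q; cbn [dpow_at0].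
- apply Rgt_not_eq, exp_pos.
- rewrite (dpow_at0_lt m (S m)) by lia. rewrite Rmult_0_r, Rminus_0_r.
  apply Rmult_integral_contrapositive_currified; [apply not_0_INR; lia|].
  replace (S m - 1)%nat with m by lia. apply IH.
Qed.

(** For [q = 0] the function is a polynomial of degree [N]. *)
Lemma dpow_at0_gt (m N : nat) : (N < m)%nat -> dpow_at0 m N 0 = 0.
Proof.
revert N; induction m as [|m IH]; intros N H; [lia|].
cbn [dpow_at0]. destruct N as [|N].
- simpl; ring.
- rewrite (IH (S N - 1)%nat) by lia. ring.
Qed.

(** * Explicit derivatives and the form on functions that are locally real *)

(** Explicit candidates for all derivatives of [G 0], with proofs of differentiability; the total
    operator [Derive_n] is evaluated through them. *)
Definition deriv_tower (G : nat -> R -> R) : Prop :=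
  forall (m : nat) (x : R), -1 < x < 1 -> is_derive (G m) x (G (S m) x).

Lemma locally_m11 (x : R) : -1 < x < 1 -> locally x (fun y => -1 < y < 1).
Proof.
intros Hx.
apply (open_and (fun y => -1 < y) (fun y => y < 1)); [apply open_gt | apply open_lt | exact Hx].
Qed.

Lemma deriv_tower_Derive_n (G : nat -> R -> R) (f : R -> R) (m : nat) (x : R) :
  deriv_tower G -> -1 < x < 1 -> locally x (fun y => f y = G 0%nat y) ->
  Derive_n f m x = G m x.
Proof.
intros HG; revert x; induction m as [|m IH]; intros x Hx Hf.
- exact (locally_singleton _ _ Hf).
- simpl. rewrite (Derive_ext_loc _ (G m)).
  + apply is_derive_unique, HG, Hx.
  + generalize (filter_and _ _ (locally_m11 x Hx) (locally_locally _ _ Hf)).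
    apply filter_imp. intros y [Hy Hfy]. now apply IH.
Qed.

Lemma deriv_tower_ex_derive_n (G : nat -> R -> R) (m : nat) (x : R) :
  deriv_tower G -> -1 < x < 1 -> ex_derive_n (G 0%nat) m x.
Proof.
intros HG Hx. destruct m as [|m]; [exact I|]. simpl.
apply (ex_derive_ext_loc (G m)).
- generalize (locally_m11 x Hx). apply filter_imp. intros y Hy. symmetry.
  apply deriv_tower_Derive_n; [exact HG | exact Hy | now apply filter_forall].
- eexists. now apply HG.
Qed.

Lemma deriv_tower_CDerive_n (G : nat -> R -> R) (f : R -> C) (m : nat) (x : R) :
  deriv_tower G -> -1 < x < 1 -> locally x (fun y => f y = RtoC (G 0%nat y)) ->
  CDerive_n f m x = RtoC (G m x).
Proof.
intros HG Hx Hf. unfold CDerive_n, RtoC. f_equal.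
- apply deriv_tower_Derive_n; [exact HG | exact Hx |].
  revert Hf. apply filter_imp. now intros y ->.
(* The imaginary part vanishes near [x], and the zero functions form a tower. *)
- apply (deriv_tower_Derive_n (fun _ _ => 0)); [|exact Hx|].
  + intros k y _. apply (is_derive_const (V := R_NormedModule)).
  + revert Hf. apply filter_imp. now intros y ->.
Qed.

Lemma locally_CDerive_n (G : nat -> R -> R) (f : R -> C) (m : nat) (x : R) :
  deriv_tower G -> -1 < x < 1 -> locally x (fun y => f y = RtoC (G 0%nat y)) ->
  locally x (fun y => CDerive_n f m y = RtoC (G m y)).
Proof.
intros HG Hx Hf.
generalize (filter_and _ _ (locally_m11 x Hx) (locally_locally _ _ Hf)).
apply filter_imp. intros y [Hy Hfy]. now apply deriv_tower_CDerive_n.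
Qed.

Lemma deriv_tower_lin (a b : R) (G H : nat -> R -> R) :
  deriv_tower G -> deriv_tower H ->
  deriv_tower (fun m x => a * G m x + b * H m x).
Proof.
intros HG HH m x Hx.
exact (is_derive_plus (V := R_NormedModule) _ _ _ _ _ (is_derive_scal _ _ a _ (HG m x Hx))
         (is_derive_scal _ _ b _ (HH m x Hx))).
Qed.

(* [P m] stands for [f^(m)] and [Q m l] for [(w_m f^(m))^(l)]. *)
Definition weighted_jet (w : nat -> R -> R) (P : nat -> R -> R)
    (Q : nat -> nat -> R -> R) : Prop :=
  deriv_tower P /\ (forall m, deriv_tower (Q m)) /\
  (forall m x, -1 < x < 1 -> w m x * P m x = Q m 0%nat x).

Lemma weighted_jet_lin (a b : R) w P Q P' Q' :
  weighted_jet w P Q -> weighted_jet w P' Q' ->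
  weighted_jet w (fun m x => a * P m x + b * P' m x)
                 (fun m l x => a * Q m l x + b * Q' m l x).
Proof.
intros [HP [HQ HPQ]] [HP' [HQ' HPQ']]. split; [|split].
- now apply deriv_tower_lin.
- intros m. now apply deriv_tower_lin.
- intros m x Hx. rewrite <- HPQ, <- HPQ' by exact Hx. ring.
Qed.

Lemma weighted_jet_CDerive_n w P Q (f : R -> C) (m l : nat) (x : R) :
  weighted_jet w P Q -> -1 < x < 1 -> locally x (fun y => f y = RtoC (P 0%nat y)) ->
  CDerive_n (fun t => RtoC (w m t) * CDerive_n f m t)%C l x = RtoC (Q m l x).
Proof.
intros [HP [HQ HPQ]] Hx Hf.
apply deriv_tower_CDerive_n; [apply HQ | exact Hx |].
generalize (filter_and _ _ (locally_m11 x Hx) (locally_CDerive_n P f m x HP Hx Hf)).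
apply filter_imp. intros y [Hy ->]. now rewrite <- RtoC_mult, HPQ.
Qed.

Lemma RtoC_sum_n_m (f : nat -> R) (a b : nat) :
  RtoC (sum_n_m f a b) = sum_n_m (fun k => RtoC (f k)) a b.
Proof.
induction b as [|b IH].
- destruct a as [|a]; [now rewrite !sum_n_n | now rewrite !sum_n_m_zero by lia].
- destruct (Compare_dec.le_lt_dec a (S b)) as [Hab|Hab].
  + rewrite !sum_n_Sm by exact Hab. rewrite <- IH.
    exact (RtoC_plus _ _).
  + now rewrite !sum_n_m_zero by lia.
Qed.

(** The expression [sesq_form] written in jets: [P], [Q] belong to the first argument, [P'], [Q'] to
    the second. Conjugation disappears because both are real near the point. *)
Definition real_form (n : nat) (P : nat -> R -> R) (Q : nat -> nat -> R -> R)
    (P' : nat -> R -> R) (Q' : nat -> nat -> R -> R) (x : R) : R :=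
  sum_n_m (fun m => sum_n_m (fun i =>
    (-1) ^ (m + i) *
    (Q' m (m - i)%nat x * P (i - 1)%nat x - Q m (m - i)%nat x * P' (i - 1)%nat x)) 1 m) 1 n.

Lemma sesq_form_real n alpha beta c P Q P' Q' (f g : R -> C) (x : R) :
  weighted_jet (jacobi_a alpha beta c) P Q ->
  weighted_jet (jacobi_a alpha beta c) P' Q' ->
  -1 < x < 1 ->
  locally x (fun y => f y = RtoC (P 0%nat y)) ->
  locally x (fun y => g y = RtoC (P' 0%nat y)) ->
  sesq_form n alpha beta c f g x = RtoC (real_form n P Q P' Q' x).
Proof.
intros HPQ HPQ' Hx Hf Hg.
assert (Hg' : locally x (fun y => Cconj (g y) = RtoC (P' 0%nat y))).
{ revert Hg. apply filter_imp. intros y ->. unfold Cconj, RtoC; simpl. now rewrite Ropp_0. }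
unfold sesq_form, real_form. rewrite RtoC_sum_n_m.
apply sum_n_m_ext. intros m. rewrite RtoC_sum_n_m.
apply sum_n_m_ext. intros i.
rewrite (weighted_jet_CDerive_n _ _ _ f m _ x HPQ Hx Hf).
rewrite (weighted_jet_CDerive_n _ _ _ _ m _ x HPQ' Hx Hg').
rewrite (deriv_tower_CDerive_n P f _ x (proj1 HPQ) Hx Hf).
rewrite (deriv_tower_CDerive_n P' _ _ x (proj1 HPQ') Hx Hg').
now rewrite RtoC_mult, RtoC_minus, !RtoC_mult.
Qed.

(** Linearity in the second argument carries boundary values from the [v k] to the combinations that
    define the [u k]. *)
Lemma real_form_lin n P Q (a b : R) P1 Q1 P2 Q2 x :
  real_form n P Q (fun m x => a * P1 m x + b * P2 m x)
                  (fun m l x => a * Q1 m l x + b * Q2 m l x) x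
  = a * real_form n P Q P1 Q1 x + b * real_form n P Q P2 Q2 x.
Proof.
unfold real_form.
rewrite <- !(sum_n_m_mult_l (K := R_Ring)).
rewrite <- (sum_n_m_plus (G := R_AbelianGroup)).
apply sum_n_m_ext; intros m.
rewrite <- !(sum_n_m_mult_l (K := R_Ring)).
rewrite <- (sum_n_m_plus (G := R_AbelianGroup)).
apply sum_n_m_ext; intros i.
unfold plus, mult; simpl; ring.
Qed.

(** * Limits at the endpoints of the interval *)

Lemma filterlim_RtoC {T : Type} {F : (T -> Prop) -> Prop} {FF : Filter F}
    (f : T -> R) (l : R) :
  filterlim f F (locally l) -> filterlim (fun x => RtoC (f x)) F (locally (RtoC l)).
Proof.
intros Hf. apply (filterlim_locally (U := C_UniformSpace)). intros e.
generalize (proj1 (filterlim_locally (U := R_UniformSpace) f l) Hf e).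
apply filter_imp. intros x Hx. split; [exact Hx | apply ball_center].
Qed.

(* The two endpoints are treated at once through [t = 1 - s x], [s = 1] or [-1]. *)
Definition endpoint_filter (s : R) (F : (R -> Prop) -> Prop) : Prop :=
  (s = 1 \/ s = -1) /\
  forall P : R -> Prop, F P <-> exists e, 0 < e /\ forall x, 0 < 1 - s * x < e -> P x.

Lemma endpoint_at_left : endpoint_filter 1 (at_left 1).
Proof.
split; [now left|]. intros P; split.
- intros [[e He] H]. exists e; split; [exact He|]. intros x Hx. apply H; [|lra].
  unfold ball; simpl; unfold AbsRing_ball, abs, minus, plus, opp; simpl.
  apply Rabs_def1; lra.
- intros [e [He H]]. exists (mkposreal e He). intros x Hx Hx1. apply H.
  unfold ball in Hx; simpl in Hx; unfold AbsRing_ball, abs, minus, plus, opp in Hx; simpl in Hx.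
  apply Rabs_def2 in Hx. lra.
Qed.

Lemma endpoint_at_right : endpoint_filter (-1) (at_right (-1)).
Proof.
split; [now right|]. intros P; split.
- intros [[e He] H]. exists e; split; [exact He|]. intros x Hx. apply H; [|lra].
  unfold ball; simpl; unfold AbsRing_ball, abs, minus, plus, opp; simpl.
  apply Rabs_def1; lra.
- intros [e [He H]]. exists (mkposreal e He). intros x Hx Hx1. apply H.
  unfold ball in Hx; simpl in Hx; unfold AbsRing_ball, abs, minus, plus, opp in Hx; simpl in Hx.
  apply Rabs_def2 in Hx. lra.
Qed.

Lemma endpoint_m11 s F : endpoint_filter s F -> F (fun x => -1 < x < 1).
Proof.
intros [Hs HF]. apply HF. exists 2; split; [lra|].
intros x Hx. destruct Hs as [-> | ->]; lra.
Qed.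

(** One-sided neighbourhoods of the endpoint are open. An identity along the filter thus holds
    around each nearby point, as is required for differentiating it there. *)
Lemma endpoint_locally s F (P : R -> Prop) :
  endpoint_filter s F -> F P -> F (fun x => locally x P).
Proof.
intros [Hs HF] HP. apply HF in HP. destruct HP as [e [He HP]].
apply HF. exists e; split; [exact He|]. intros x Hx.
(* The radius is the distance from [x] to the nearer end of the one-sided interval. *)
assert (Hd : 0 < Rmin (1 - s * x) (e - (1 - s * x))) by (apply Rmin_glb_lt; lra).
exists (mkposreal _ Hd). intros y Hy. apply HP.
unfold ball in Hy; simpl in Hy; unfold AbsRing_ball, abs, minus, plus, opp in Hy; simpl in Hy.
pose proof (Rmin_l (1 - s * x) (e - (1 - s * x))).
pose proof (Rmin_r (1 - s * x) (e - (1 - s * x))).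
apply Rabs_def2 in Hy. destruct Hs as [-> | ->]; lra.
Qed.

Lemma endpoint_filterlim s F (h : R -> R) (l : R) :
  endpoint_filter s F -> filterlim h (at_right 0) (locally l) ->
  filterlim (fun x => h (1 - s * x)) F (locally l).
Proof.
intros [Hs HF] Hh. apply (filterlim_comp _ _ _ _ h F (at_right 0)); [|exact Hh].
intros P [[e He] HP]. apply HF. exists e; split; [exact He|].
intros x Hx. apply HP; [|lra].
unfold ball; simpl; unfold AbsRing_ball, abs, minus, plus, opp; simpl.
apply Rabs_def1; lra.
Qed.

(** * Jets of the powers of the distance to an endpoint *)

Lemma is_derive_dpow_reflect (s : R) (m : nat) (p q x : R) :
  s = 1 \/ s = -1 -> -1 < x < 1 ->
  is_derive (fun x => dpow m p q (1 - s * x)) x (- s * dpow (S m) p q (1 - s * x)).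
Proof.
intros Hs Hx.
apply (is_derive_comp (V := R_NormedModule) (dpow m p q) (fun x => 1 - s * x)).
- apply is_derive_dpow. destruct Hs as [-> | ->]; lra.
- auto_derive; [exact I | ring].
Qed.

(** The derivatives in [x] of [(1 - s x)^p]; each differentiation contributes a factor [- s]. *)
Definition pow_tower (s p : R) (m : nat) (x : R) : R :=
  (- s) ^ m * dpow m p 0 (1 - s * x).

(** Here [a] is the weight exponent at the chosen endpoint and [b] the one at the other. The [m]
    powers lost by differentiating [(1 - s x)^p] are restored by the weight, which leaves the
    exponent [a + p]. *)
Definition weighted_pow_tower (s a b : R) (c : nat -> R) (p : R) (m l : nat) (x : R) : R :=
  c m * falling p m * (- s) ^ (m + l) * dpow l (a + p) (b + INR m) (1 - s * x).

Lemma weighted_jet_pow s a b c p w :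
  s = 1 \/ s = -1 ->
  (forall m x, -1 < x < 1 ->
     w m x = c m * (Rpower (1 - s * x) (a + INR m) * Rpower (1 + s * x) (b + INR m))) ->
  weighted_jet w (pow_tower s p) (weighted_pow_tower s a b c p).
Proof.
intros Hs Hw. split; [|split].
- intros m x Hx. unfold pow_tower.
  replace ((- s) ^ S m * dpow (S m) p 0 (1 - s * x))
    with ((- s) ^ m * (- s * dpow (S m) p 0 (1 - s * x))) by (simpl pow; ring).
  apply (is_derive_scal (fun x => dpow m p 0 (1 - s * x))).
  now apply is_derive_dpow_reflect.
- intros m l x Hx. unfold weighted_pow_tower.
  replace (c m * falling p m * (- s) ^ (m + S l) * dpow (S l) (a + p) (b + INR m) (1 - s * x))
    with (c m * falling p m * (- s) ^ (m + l)
          * (- s * dpow (S l) (a + p) (b + INR m) (1 - s * x)))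
    by (rewrite Nat.add_succ_r; simpl pow; ring).
  apply (is_derive_scal (fun x => dpow l (a + p) (b + INR m) (1 - s * x))).
  now apply is_derive_dpow_reflect.
- intros m x Hx. rewrite (Hw m x Hx). unfold pow_tower, weighted_pow_tower.
  assert (Ht : 0 < 1 - s * x < 2) by (destruct Hs as [-> | ->]; lra).
  rewrite dpow_0 by lra. cbn [dpow]. rewrite Nat.add_0_r.
  replace (a + p) with ((a + INR m) + (p - INR m)) by ring.
  rewrite (Rpower_plus (a + INR m)).
  replace (2 - (1 - s * x)) with (1 + s * x) by ring. ring.
Qed.

Lemma pow_tower_0 s p x : s = 1 \/ s = -1 -> -1 < x < 1 ->
  pow_tower s p 0 x = Rpower (1 - s * x) p.
Proof.
intros Hs Hx. unfold pow_tower.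
assert (Ht : 0 < 1 - s * x < 2) by (destruct Hs as [-> | ->]; lra).
rewrite dpow_0 by lra. simpl. rewrite Rminus_0_r. ring.
Qed.

(** * The triangular matrix of the brackets of [phi_j] with [v_k] *)

Definition boundary_value (n : nat) (s a b : R) (c : nat -> R) (j k : nat) : R :=
  sum_n_m (fun m => sum_n_m (fun i =>
    (-1) ^ (m + i) *
    (c m * falling (- a + INR n - INR k) m * (- s) ^ (m + (m - i))
       * dpow_at0 (m - i) (n - k) (b + INR m)
     * ((- s) ^ (i - 1) * dpow_at0 (i - 1) (j - 1) 0))) 1 m) 1 n.

(** The factor from [phi_j] vanishes unless [i = j]. Then [m - j] differentiations cannot remove the
    zero of order [n - k], because [m <= n] and [k < j]. *)
Lemma boundary_value_gt n s a b c j k :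
  (1 <= j <= n)%nat -> (1 <= k <= n)%nat -> (k < j)%nat ->
  boundary_value n s a b c j k = 0.
Proof.
intros Hj Hk Hkj. apply sum_n_m_eq0; intros m Hm. apply sum_n_m_eq0; intros i Hi.
destruct (Nat.lt_total i j) as [H | [-> | H]].
- rewrite (dpow_at0_lt (i - 1)) by lia. ring.
- rewrite (dpow_at0_lt (m - j)) by lia. ring.
- rewrite (dpow_at0_gt (i - 1)) by lia. ring.
Qed.

(** Nonzero factors force [i = k] and then [m - k >= n - k], that is [m = n]; a single product
    remains. *)
Lemma boundary_value_diag n s a b c k :
  s = 1 \/ s = -1 -> 0 < a < 1 -> c n <> 0 -> (1 <= k <= n)%nat ->
  boundary_value n s a b c k k <> 0.
Proof.
intros Hs Ha Hc Hk. unfold boundary_value.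
rewrite (sum_n_m_single _ 1 n n), (sum_n_m_single _ 1 k n).
- assert (Hs0 : - s <> 0) by (destruct Hs as [-> | ->]; lra).
  repeat apply Rmult_integral_contrapositive_currified;
    try apply pow_nonzero; try apply dpow_at0_diag; try assumption; try lra.
  (* A vanishing factor would make [a] an integer strictly between 0 and 1. *)
  apply falling_neq0. intros i Hi E. rewrite <- Rplus_0_r in E.
  assert (E' : IZR (Z.of_nat n - Z.of_nat k - Z.of_nat i) = a).
  { rewrite !minus_IZR, <- !INR_IZR_INZ. lra. }
  rewrite <- E' in Ha. destruct Ha as [H1 H2].
  apply lt_IZR in H1. apply lt_IZR in H2. lia.
- lia.
- intros i Hi Hik. destruct (Nat.lt_gt_cases i k) as [[H | H] _]; [exact Hik| |].
  + rewrite (dpow_at0_lt (i - 1)) by lia. ring.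
  + rewrite (dpow_at0_gt (i - 1)) by lia. ring.
- lia.
- intros m Hm Hmn. apply sum_n_m_eq0; intros i Hi.
  destruct (Nat.lt_total i k) as [H | [-> | H]].
  + rewrite (dpow_at0_lt (i - 1)) by lia. ring.
  + rewrite (dpow_at0_lt (m - k)) by lia. ring.
  + rewrite (dpow_at0_gt (i - 1)) by lia. ring.
Qed.

Lemma real_form_pow_lim n s F {FF : ProperFilter F} a b c j k :
  endpoint_filter s F -> (1 <= j <= n)%nat -> (1 <= k <= n)%nat ->
  filterlim
    (real_form n (pow_tower s (INR (j - 1))) (weighted_pow_tower s a b c (INR (j - 1)))
       (pow_tower s (- a + INR n - INR k))
       (weighted_pow_tower s a b c (- a + INR n - INR k)))
    F (locally (boundary_value n s a b c j k)).
Proof.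
intros HF Hj Hk. unfold boundary_value.
apply filterlim_sum_n_m; intros m Hm. apply filterlim_sum_n_m; intros i Hi.
apply filterlim_Rscal.
apply (filterlim_locally_eq _ (c m * falling (- a + INR n - INR k) m * (- s) ^ (m + (m - i))
       * dpow_at0 (m - i) (n - k) (b + INR m)
     * ((- s) ^ (i - 1) * dpow_at0 (i - 1) (j - 1) 0) + (-1) * 0)); [ring|].
apply (filterlim_ext (fun x =>
  weighted_pow_tower s a b c (- a + INR n - INR k) m (m - i) x
    * pow_tower s (INR (j - 1)) (i - 1) x
  + (-1) * (weighted_pow_tower s a b c (INR (j - 1)) m (m - i) x
    * pow_tower s (- a + INR n - INR k) (i - 1) x))); [intros x; ring|].
apply filterlim_Rplus; [|apply filterlim_Rscal].
(* In this half the exponent [a + p] is the natural number [n - k], so both factors have limits of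
   the form [dpow_at0]. *)
- apply filterlim_Rmult; apply filterlim_Rscal;
    apply (endpoint_filterlim s F (dpow _ _ _) _ HF); [|apply dpow_at0_lim].
  replace (a + (- a + INR n - INR k)) with (INR (n - k)) by (rewrite minus_INR by lia; ring).
  apply dpow_at0_lim.
(* In the other half the [m]-th derivative of [phi_j] is identically 0 for [m > j - 1]; otherwise a
   positive power of [t] remains. *)
- destruct (Nat.lt_ge_cases (j - 1) m) as [Hjm | Hjm].
  + apply (filterlim_ext (fun _ => 0)); [|apply filterlim_const].
    intros x. unfold weighted_pow_tower. rewrite falling_INR_eq0 by exact Hjm. ring.
  + set (K := c m * falling (INR (j - 1)) m * (- s) ^ (m + (m - i)) *
              ((- s) ^ (i - 1) * falling (- a + INR n - INR k) (i - 1))).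
    apply (filterlim_ext_loc (fun x => K *
      (Rpower (1 - s * x) (- a + INR n - INR k - INR (i - 1))
        * dpow (m - i) (a + INR (j - 1)) (b + INR m) (1 - s * x)))).
    * generalize (endpoint_m11 s F HF). apply filter_imp. intros x Hx.
      unfold weighted_pow_tower, pow_tower, K. rewrite (dpow_0 (i - 1)); [ring|].
      destruct HF as [[-> | ->] _]; lra.
    * apply (filterlim_locally_eq _ (K * 0)); [ring|]. apply filterlim_Rscal.
      apply (endpoint_filterlim s F (fun t => Rpower t (- a + INR n - INR k - INR (i - 1))
        * dpow (m - i) (a + INR (j - 1)) (b + INR m) t) _ HF).
      (* After cancellation of [a] and [i] the exponent is [n - k + j - m], which is at least 1. *)
      apply dpow_lim_0. rewrite !minus_INR by lia.
      apply le_INR in Hjm. rewrite minus_INR in Hjm by lia.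
      assert (H2 : INR k <= INR n) by (apply le_INR; lia).
      simpl (INR 1) in *. lra.
Qed.

(** * Boundary values of the recursively defined family *)

(* [g] is real near the endpoint, and [l j] is the boundary value of its bracket
   with [(1 - s x)^(j-1)]. *)
Definition has_boundary_values (n : nat) (s a b : R) (c : nat -> R)
    (F : (R -> Prop) -> Prop) (w : nat -> R -> R) (g : R -> C) (l : nat -> R) : Prop :=
  exists (P : nat -> R -> R) (Q : nat -> nat -> R -> R),
    weighted_jet w P Q /\ F (fun x => g x = RtoC (P 0%nat x)) /\
    forall j, (1 <= j <= n)%nat ->
      filterlim (real_form n (pow_tower s (INR (j - 1)))
                   (weighted_pow_tower s a b c (INR (j - 1))) P Q) F (locally (l j)).

Lemma has_boundary_values_lin n s a b c F {FF : ProperFilter F} w (u v : R) g h f l l' L :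
  has_boundary_values n s a b c F w g l -> has_boundary_values n s a b c F w h l' ->
  F (fun x => f x = (RtoC u * g x + RtoC v * h x)%C) ->
  (forall j, (1 <= j <= n)%nat -> L j = u * l j + v * l' j) ->
  has_boundary_values n s a b c F w f L.
Proof.
intros [P [Q [HPQ [Hg Hl]]]] [P' [Q' [HPQ' [Hh Hl']]]] Hf HL.
exists (fun m x => u * P m x + v * P' m x), (fun m i x => u * Q m i x + v * Q' m i x).
split; [|split].
- now apply weighted_jet_lin.
- generalize (filter_and _ _ Hf (filter_and _ _ Hg Hh)). apply filter_imp.
  intros x [-> [-> ->]]. now rewrite <- !RtoC_mult, <- RtoC_plus.
- intros j Hj. rewrite HL by exact Hj.
  eapply filterlim_ext; [intros x; symmetry; apply real_form_lin|].
  apply filterlim_Rplus; apply filterlim_Rscal; auto.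
Qed.

(** Limits along a proper filter are unique, so [iota] returns the given one. *)
Lemma sesq_form_lim_eq n alpha beta c F {FF : ProperFilter F} f g l :
  is_sesq_form_lim n alpha beta c F f g l -> sesq_form_lim n alpha beta c F f g = l.
Proof.
intros H.
exact (iota_filterlim_locally (V := C_R_CompleteNormedModule) (sesq_form n alpha beta c f g) l H).
Qed.

Lemma has_boundary_values_lim n s a b c F {FF : ProperFilter F} alpha beta f g l j :
  endpoint_filter s F ->
  (forall m x, -1 < x < 1 -> jacobi_a alpha beta c m x =
     c m * (Rpower (1 - s * x) (a + INR m) * Rpower (1 + s * x) (b + INR m))) ->
  (1 <= j <= n)%nat ->
  F (fun x => f x = RtoC ((1 - s * x) ^ (j - 1))) ->
  has_boundary_values n s a b c F (jacobi_a alpha beta c) g l ->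
  is_sesq_form_lim n alpha beta c F f g (RtoC (l j)).
Proof.
intros HF Hw Hj Hf [P [Q [HPQ [Hg Hl]]]].
assert (Hf' : F (fun x => f x = RtoC (pow_tower s (INR (j - 1)) 0 x))).
{ generalize (filter_and _ _ Hf (endpoint_m11 s F HF)). apply filter_imp.
  intros x [-> Hx]. rewrite pow_tower_0, Rpower_pow; [reflexivity | | apply HF | exact Hx].
  destruct HF as [[-> | ->] _]; lra. }
unfold is_sesq_form_lim.
eapply filterlim_ext_loc; [|apply filterlim_RtoC, (Hl j Hj)].
generalize (filter_and _ _ (endpoint_m11 s F HF)
  (filter_and _ _ (endpoint_locally s F _ HF Hf') (endpoint_locally s F _ HF Hg))).
apply filter_imp. intros x [Hx [Hfx Hgx]]. symmetry.
apply sesq_form_real; try assumption.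
apply weighted_jet_pow; [apply HF | exact Hw].
Qed.

Definition delta (j k : nat) : R := if Nat.eqb j k then 1 else 0.

(** Strong induction on [k]. For [j < k] the bracket of [phi_j] with [u_j] is already 1, so the
    coefficient of [u_j] is [B j k]. Subtraction clears the entries above the diagonal,
    triangularity gives those below, and the division makes the diagonal entry 1. *)
Lemma recursive_family_boundary_values n s a b c F {FF : ProperFilter F} alpha beta
    (phi v u : nat -> R -> C) :
  endpoint_filter s F -> 0 < a < 1 -> c n <> 0 ->
  (forall m x, -1 < x < 1 -> jacobi_a alpha beta c m x =
     c m * (Rpower (1 - s * x) (a + INR m) * Rpower (1 + s * x) (b + INR m))) ->
  (forall j, (1 <= j <= n)%nat -> F (fun x => phi j x = RtoC ((1 - s * x) ^ (j - 1)))) ->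
  (forall k, (1 <= k <= n)%nat ->
     F (fun x => v k x = RtoC (Rpower (1 - s * x) (- a + INR n - INR k)))) ->
  recursive_family n (sesq_form_lim n alpha beta c F) phi v u ->
  forall k, (1 <= k <= n)%nat ->
  has_boundary_values n s a b c F (jacobi_a alpha beta c) (u k) (fun j => delta j k).
Proof.
intros HF Ha Hc Hw Hphi Hv Hrec k.
set (w := jacobi_a alpha beta c) in *.
set (B := boundary_value n s a b c).
assert (Hvk : forall k, (1 <= k <= n)%nat ->
  has_boundary_values n s a b c F w (v k) (fun j => B j k)).
{ intros i Hi. exists (pow_tower s (- a + INR n - INR i)),
    (weighted_pow_tower s a b c (- a + INR n - INR i)).
  split; [apply weighted_jet_pow; [apply HF | exact Hw]|]. split.
  - generalize (filter_and _ _ (Hv i Hi) (endpoint_m11 s F HF)). apply filter_imp.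
    intros x [-> Hx]. rewrite pow_tower_0; [reflexivity | apply HF | exact Hx].
  - intros j Hj. now apply real_form_pow_lim. }
assert (Hbr : forall g l j, has_boundary_values n s a b c F w g l -> (1 <= j <= n)%nat ->
  sesq_form_lim n alpha beta c F (phi j) g = RtoC (l j)).
{ intros g l j Hg Hj. apply (sesq_form_lim_eq n alpha beta c F).
  apply (has_boundary_values_lim n s a b c F alpha beta); auto. }
induction k as [k IH] using (well_founded_induction Wf_nat.lt_wf). intros Hk.
(* Subtracting the first [K] terms annihilates exactly the entries [j <= K] and leaves the others
   alone, since [u_j] pairs only with [phi_j]. *)
assert (Hsum : forall K, (K < k)%nat ->
  has_boundary_values n s a b c F w
    (fun x => (v k x - sum_n_m (fun j => RtoC (B j k) * u j x) 1 K)%C)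
    (fun j => if Nat.leb j K then 0 else B j k)).
{ induction K as [|K IHK]; intros HK.
  (* The sum is empty; a second copy of [v k] with coefficient 0 fills the binary combination. *)
  - apply (has_boundary_values_lin n s a b c F w 1 0 (v k) (v k) _ _ _ _ (Hvk k Hk) (Hvk k Hk)).
    + apply filter_forall. intros x. rewrite sum_n_m_zero by lia.
      change zero with (RtoC 0). ring.
    + intros j Hj. destruct (Nat.leb_spec j 0); [lia | ring].
  - apply (has_boundary_values_lin n s a b c F w 1 (- B (S K) k) _ _ _ _ _ _
      (IHK ltac:(lia)) (IH (S K) HK ltac:(lia))).
    + apply filter_forall. intros x. rewrite sum_n_Sm by lia. rewrite RtoC_opp.
      match goal with |- context [plus ?X ?Y] => change (plus X Y) with (Cplus X Y) end. ring.
    + intros j Hj. unfold delta.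
      destruct (Nat.leb_spec j K), (Nat.leb_spec j (S K)), (Nat.eqb_spec j (S K));
        try lia; subst; ring. }
assert (HBk : B k k <> 0) by (apply boundary_value_diag; [apply HF | assumption ..]).
apply (has_boundary_values_lin n s a b c F w (/ B k k) 0 _ _ _ _ _ _
  (Hsum (k - 1)%nat ltac:(lia)) (Hvk k Hk)).
- generalize (endpoint_m11 s F HF). apply filter_imp. intros x Hx.
  rewrite (Hrec k Hk x Hx).
  rewrite (Hbr _ _ k (Hvk k Hk) Hk), RtoC_inv by exact HBk.
  rewrite (sum_n_m_ext_loc _ (fun j => (RtoC (B j k) * u j x)%C)).
  + unfold Cdiv. ring.
  + intros j Hj. rewrite (Hbr _ _ j (Hvk k Hk)) by lia.
    rewrite (Hbr _ _ j (IH j ltac:(lia) ltac:(lia))) by lia.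
    unfold delta. rewrite Nat.eqb_refl.
    match goal with |- ?X = ?Y => change (@eq C X Y) end. field.
- intros j Hj. unfold delta.
  (* The cases are [j < k] (cleared), [j = k] (normalised) and [j > k] (zero by triangularity). *)
  destruct (Nat.leb_spec j (k - 1)), (Nat.eqb_spec j k); try lia.
  + ring.
  + subst. field. exact HBk.
  + assert (E : B j k = 0) by (apply boundary_value_gt; lia). rewrite E. ring.
Qed.

(** * Iterates of the Jacobi expression on powers, and the top coefficient *)

(* [(d/dt)^d] of [l^n[t^p]] in the variable [t = 1 - x], from
   [l[t^p] = -2p(alpha+p) t^(p-1) + p(p+alpha+beta+1) t^p]. *)
Fixpoint jacobi_iter_pow (alpha beta : R) (n d : nat) (p t : R) : R :=
  match n with
  | O => dpow d p 0 t
  | S n => - 2 * p * (alpha + p) * jacobi_iter_pow alpha beta n d (p - 1) t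
           + p * (p + alpha + beta + 1) * jacobi_iter_pow alpha beta n d p t
  end.

Lemma is_derive_jacobi_iter_pow alpha beta n d p t :
  0 < t < 2 ->
  is_derive (jacobi_iter_pow alpha beta n d p) t (jacobi_iter_pow alpha beta n (S d) p t).
Proof.
intros Ht. revert p; induction n as [|n IH]; intros p.
- exact (is_derive_dpow d p 0 t Ht).
- exact (is_derive_plus (V := R_NormedModule) _ _ _ _ _
    (is_derive_scal _ _ (- 2 * p * (alpha + p)) _ (IH (p - 1)))
    (is_derive_scal _ _ (p * (p + alpha + beta + 1)) _ (IH p))).
Qed.

(** The left side is the Jacobi expression in the variable [t]. For [n = 0] it is computed on [t^p];
    afterwards both sides satisfy the same linear recursion in [n]. *)
Lemma jacobi_iter_pow_ode alpha beta n p t :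
  0 < t < 2 ->
  - (t * (2 - t) * jacobi_iter_pow alpha beta n 2 p t
     + ((alpha + 1) * (2 - t) - (beta + 1) * t) * jacobi_iter_pow alpha beta n 1 p t)
  = jacobi_iter_pow alpha beta (S n) 0 p t.
Proof.
intros Ht. revert p; induction n as [|n IH]; intros p.
- cbn [jacobi_iter_pow]. rewrite !dpow_0 by lra. simpl.
  replace (p - (1 + 1)) with (p - 1 - 1) by ring. rewrite !Rminus_0_r.
  rewrite !Rpower_pred by lra. field; lra.
- change (jacobi_iter_pow alpha beta (S (S n)) 0 p t)
    with (- 2 * p * (alpha + p) * jacobi_iter_pow alpha beta (S n) 0 (p - 1) t
           + p * (p + alpha + beta + 1) * jacobi_iter_pow alpha beta (S n) 0 p t).
  rewrite <- !IH. cbn [jacobi_iter_pow]. ring.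
Qed.

(** Each application lowers the exponent by at most 1. *)
Lemma jacobi_iter_pow_lim_0 alpha beta n r p :
  0 < r + p - INR n ->
  filterlim (fun t => Rpower t r * jacobi_iter_pow alpha beta n 0 p t)
    (at_right 0) (locally 0).
Proof.
revert p; induction n as [|n IH]; intros p H.
- apply dpow_lim_0. exact H.
- rewrite S_INR in H.
  apply (filterlim_ext (fun t =>
    - 2 * p * (alpha + p) * (Rpower t r * jacobi_iter_pow alpha beta n 0 (p - 1) t)
    + p * (p + alpha + beta + 1) * (Rpower t r * jacobi_iter_pow alpha beta n 0 p t))).
  { intros t. cbn [jacobi_iter_pow]. ring. }
  apply (filterlim_locally_eq _ (- 2 * p * (alpha + p) * 0
    + p * (p + alpha + beta + 1) * 0)); [ring|].
  apply filterlim_Rplus; apply filterlim_Rscal; apply IH; lra.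
Qed.

(** Only the branch that lowers the exponent every time survives; the limit is the product of its
    coefficients [-2p(alpha+p)] over [p], [p - 1], and so on. *)
Lemma jacobi_iter_pow_lim_critical alpha beta n r p :
  r + p - INR n = 0 ->
  filterlim (fun t => Rpower t r * jacobi_iter_pow alpha beta n 0 p t)
    (at_right 0) (locally ((- 2) ^ n * falling p n * falling (alpha + p) n)).
Proof.
revert p; induction n as [|n IH]; intros p H.
- apply (filterlim_locally_eq _ (falling p 0 * Rpower 2 0)).
  + rewrite Rpower_O by lra. simpl; ring.
  + apply dpow_lim_critical. exact H.
- rewrite S_INR in H.
  apply (filterlim_ext (fun t =>
    - 2 * p * (alpha + p) * (Rpower t r * jacobi_iter_pow alpha beta n 0 (p - 1) t)
    + p * (p + alpha + beta + 1) * (Rpower t r * jacobi_iter_pow alpha beta n 0 p t))).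
  { intros t. cbn [jacobi_iter_pow]. ring. }
  apply (filterlim_locally_eq _ (- 2 * p * (alpha + p)
      * ((- 2) ^ n * falling (p - 1) n * falling (alpha + (p - 1)) n)
    + p * (p + alpha + beta + 1) * 0)).
  { replace (alpha + (p - 1)) with (alpha + p - 1) by ring. cbn [falling pow]. ring. }
  apply filterlim_Rplus; apply filterlim_Rscal; [apply IH; lra|].
  apply jacobi_iter_pow_lim_0; lra.
Qed.

Lemma CDerive_n_1 (f : R -> C) (g : R -> R) (x l : R) :
  locally x (fun y => f y = RtoC (g y)) -> is_derive g x l -> CDerive_n f 1 x = RtoC l.
Proof.
intros Hf Hg. unfold CDerive_n, RtoC. simpl. f_equal.
- apply is_derive_unique. apply (is_derive_ext_loc g); [|exact Hg].
  revert Hf. apply filter_imp. now intros y ->.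
- apply is_derive_unique. apply (is_derive_ext_loc (fun _ => 0)).
  + revert Hf. apply filter_imp. now intros y ->.
  + apply (is_derive_const (V := R_NormedModule)).
Qed.

Lemma is_derive_jacobi_weight alpha beta x :
  -1 < x < 1 ->
  is_derive (jacobi_weight alpha beta) x
    (jacobi_weight alpha beta x * (beta / (1 + x) - alpha / (1 - x))).
Proof.
intros Hx. unfold jacobi_weight, Rpower.
auto_derive; [lra | unfold Rminus; field; lra].
Qed.

Lemma jacobi_weight_succ alpha beta x :
  -1 < x < 1 ->
  jacobi_weight (alpha + 1) (beta + 1) x = jacobi_weight alpha beta x * ((1 - x) * (1 + x)).
Proof.
intros Hx. unfold jacobi_weight. rewrite !Rpower_plus, !Rpower_1 by lra. ring.
Qed.

Lemma jacobi_weight_pos alpha beta x : 0 < jacobi_weight alpha beta x.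
Proof. apply Rmult_lt_0_compat; apply exp_pos. Qed.

(** The product rule expands the outer derivative, division by the weight leaves polynomial
    coefficients, and [jacobi_iter_pow_ode] with [t = 1 - x] gives the next iterate. *)
Lemma jacobi_expr_iter_pow alpha beta n p (h : R -> C) x :
  (forall y, -1 < y < 1 -> h y = RtoC (jacobi_iter_pow alpha beta n 0 p (1 - y))) ->
  -1 < x < 1 ->
  jacobi_expr alpha beta h x = RtoC (jacobi_iter_pow alpha beta (S n) 0 p (1 - x)).
Proof.
intros Hh Hx.
assert (HD : forall d y, -1 < y < 1 ->
  is_derive (fun y => jacobi_iter_pow alpha beta n d p (1 - y)) y
    (- jacobi_iter_pow alpha beta n (S d) p (1 - y))).
{ intros d y Hy.
  replace (- jacobi_iter_pow alpha beta n (S d) p (1 - y))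
    with (scal (-1) (jacobi_iter_pow alpha beta n (S d) p (1 - y)))
    by (unfold scal; simpl; unfold mult; simpl; ring).
  apply (is_derive_comp (V := R_NormedModule) (jacobi_iter_pow alpha beta n d p)
           (fun y => 1 - y)).
  - apply is_derive_jacobi_iter_pow; lra.
  - auto_derive; [exact I | ring]. }
set (W := jacobi_weight (alpha + 1) (beta + 1)).
set (E d := jacobi_iter_pow alpha beta n d p (1 - x)).
assert (HW : CDerive_n (fun t => RtoC (W t) * CDerive_n h 1 t)%C 1 x
  = RtoC (W x * ((beta + 1) / (1 + x) - (alpha + 1) / (1 - x)) * - E 1%nat + W x * E 2%nat)).
{ apply (CDerive_n_1 _ (fun y => W y * - jacobi_iter_pow alpha beta n 1 p (1 - y))).
  - generalize (locally_m11 x Hx). apply filter_imp. intros y Hy.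
    rewrite (CDerive_n_1 h _ y _ (filter_imp _ _ Hh (locally_m11 y Hy)) (HD 0%nat y Hy)).
    now rewrite RtoC_mult.
  - apply (is_derive_mult W (fun y => - jacobi_iter_pow alpha beta n 1 p (1 - y))).
    + apply is_derive_jacobi_weight, Hx.
    + replace (E 2%nat) with (opp (- E 2%nat)) by (unfold opp; simpl; ring).
      apply (is_derive_opp (V := R_NormedModule)), HD, Hx.
    + intros u v; apply Rmult_comm. }
unfold jacobi_expr. fold W. rewrite HW.
rewrite <- jacobi_iter_pow_ode by lra. fold (E 1%nat) (E 2%nat).
rewrite <- RtoC_mult, <- RtoC_opp. f_equal.
unfold W. rewrite jacobi_weight_succ by exact Hx.
pose proof (jacobi_weight_pos alpha beta x). field. lra.
Qed.

(* Test the identity on [f(x) = (1-x)^(-1)], multiply by [(1-x)^(n+1)] and let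
   [x] tend to [1]: on the right only the summand [k = n] survives, and the left
   side has a nonzero limit. *)
Lemma lagrange_coefficient_top n alpha beta c :
  0 < alpha < 1 -> (1 <= n)%nat -> lagrange_coefficients n alpha beta c -> c n <> 0.
Proof.
intros Ha Hn Hc Hcn.
(* Neither -1 nor [alpha - 1] is a natural number, so both falling factorials in the critical limit
   are nonzero. *)
set (p := -1).
set (f := fun x => RtoC (pow_tower 1 p 0 x)).
assert (Hs : 1 = 1 \/ 1 = -1) by now left.
assert (Hjet : weighted_jet (jacobi_a alpha beta c) (pow_tower 1 p)
                 (weighted_pow_tower 1 alpha beta c p)).
{ apply weighted_jet_pow; [exact Hs|]. intros m x _. unfold jacobi_a, jacobi_weight.
  now rewrite Rmult_1_l. }
assert (Hsm : smooth_on_m11 f).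
{ intros m x Hx; split.
  - apply (deriv_tower_ex_derive_n (pow_tower 1 p)); [apply Hjet | exact Hx].
  - apply (deriv_tower_ex_derive_n (fun _ _ => 0)); [|exact Hx].
    intros k y _. apply (is_derive_const (V := R_NormedModule)). }
assert (Hiter : forall m x, -1 < x < 1 ->
  Nat.iter m (jacobi_expr alpha beta) f x = RtoC (jacobi_iter_pow alpha beta m 0 p (1 - x))).
{ induction m as [|m IH]; intros x Hx.
  - unfold f, pow_tower. simpl. f_equal. now rewrite !Rmult_1_l.
  - simpl Nat.iter. now apply jacobi_expr_iter_pow. }
assert (Hid : forall x, -1 < x < 1 -> jacobi_iter_pow alpha beta n 0 p (1 - x) =
  / jacobi_weight alpha beta x *
  sum_n_m (fun k => (-1) ^ k * weighted_pow_tower 1 alpha beta c p k k x) 1 n).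
{ intros x Hx. apply RtoC_inj. rewrite <- Hiter, (Hc f Hsm x Hx) by exact Hx.
  rewrite RtoC_mult, RtoC_sum_n_m. f_equal. apply sum_n_m_ext. intros k.
  rewrite RtoC_mult. f_equal.
  apply (weighted_jet_CDerive_n _ _ _ _ _ _ _ Hjet Hx), filter_forall. reflexivity. }
(* With [r = n + 1] the iterate on the left is exactly critical. *)
set (r := INR n - p).
pose proof endpoint_at_left as HF.
assert (H1 := endpoint_filterlim 1 (at_left 1) _ _ HF
  (jacobi_iter_pow_lim_critical alpha beta n r p ltac:(unfold r; ring))).
cbv beta in H1.
assert (H2 : filterlim (fun x => Rpower (1 - 1 * x) r
   * jacobi_iter_pow alpha beta n 0 p (1 - 1 * x)) (at_left 1) (locally 0)).
(* The inverse weight is split: its singular factor lowers [r] to [r - alpha], and the factor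
   [(1 + x)^(-beta)] stays bounded. *)
{ apply (filterlim_ext_loc (fun x => Rpower (2 - (1 - 1 * x)) (- beta) *
    sum_n_m (fun k => (-1) ^ k * (c k * falling p k * (- (1)) ^ (k + k)) *
      (Rpower (1 - 1 * x) (r - alpha)
       * dpow k (alpha + p) (beta + INR k) (1 - 1 * x))) 1 n)).
  - generalize (endpoint_m11 _ _ HF). apply filter_imp. intros x Hx.
    replace (jacobi_iter_pow alpha beta n 0 p (1 - 1 * x))
      with (jacobi_iter_pow alpha beta n 0 p (1 - x)) by (f_equal; ring).
    rewrite Hid by exact Hx. unfold jacobi_weight.
    replace (1 - 1 * x) with (1 - x) by ring.
    replace (2 - (1 - x)) with (1 + x) by ring.
    rewrite Rinv_mult, <- !Rpower_Ropp.
    transitivity (Rpower (1 + x) (- beta) * (Rpower (1 - x) (r - alpha) *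
      sum_n_m (fun k => (-1) ^ k * weighted_pow_tower 1 alpha beta c p k k x) 1 n)).
    + f_equal. rewrite <- (sum_n_m_mult_l (K := R_Ring)).
      apply sum_n_m_ext. intros k. unfold mult, weighted_pow_tower; simpl.
      replace (1 - 1 * x) with (1 - x) by ring. ring.
    + replace (Rpower (1 - x) (r - alpha))
        with (Rpower (1 - x) r * Rpower (1 - x) (- alpha))
        by (symmetry; apply Rpower_plus).
      ring.
  - apply (filterlim_locally_eq _ (Rpower 2 (- beta) * sum_n_m (fun _ => 0) 1 n)).
    { rewrite sum_n_m_eq0 by reflexivity. ring. }
    apply filterlim_Rmult.
    + apply (endpoint_filterlim 1 (at_left 1) (fun t => Rpower (2 - t) (- beta)) _ HF).
      apply filterlim_Rpower_2.
    + apply filterlim_sum_n_m. intros k Hk.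
      (* The summand [k = n] is killed by the assumption [c n = 0]; for [k < n] the exponent of [t]
         is [n - k > 0]. *)
      destruct (Nat.eq_dec k n) as [-> | Hkn].
      * apply (filterlim_ext (fun _ => 0)); [intros x; rewrite Hcn; ring|].
        apply filterlim_const.
      * apply (filterlim_locally_eq _ ((-1) ^ k * (c k * falling p k * (- (1)) ^ (k + k)) * 0));
          [ring|].
        apply filterlim_Rscal.
        apply (endpoint_filterlim 1 (at_left 1) (fun t => Rpower t (r - alpha)
          * dpow k (alpha + p) (beta + INR k) t) _ HF).
        apply dpow_lim_0. assert (Hlt : INR k < INR n) by (apply lt_INR; lia).
        unfold r. lra. }
(* Uniqueness of limits equates the nonzero critical limit with 0. *)
apply (filterlim_locally_unique (V := R_NormedModule) _ _ _ H1) in H2.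
revert H2.
repeat apply Rmult_integral_contrapositive_currified;
  [apply pow_nonzero; lra | apply falling_neq0 | apply falling_neq0];
  intros i _; pose proof (pos_INR i); unfold p; lra.
Qed.

(** * Specialisation to the two endpoints *)

Theorem theorem4p8 :
  forall (n : nat) (alpha beta : R),
  (0 < alpha < 1)%R -> (0 < beta < 1)%R ->
  forall c : nat -> R, lagrange_coefficients n alpha beta c ->
  forall phip vp phim vm : nat -> R -> C,
  families_plus n alpha phip vp ->
  families_minus n beta phim vm ->
  forall up um : nat -> R -> C,
  recursive_family n (sesq_form_lim n alpha beta c (at_left 1)) phip vp up ->
  recursive_family n (sesq_form_lim n alpha beta c (at_right (-1))) phim vm um ->
  forall j k : nat, (1 <= j <= n)%nat -> (1 <= k <= n)%nat ->
  (j <> k ->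
     is_sesq_form_lim n alpha beta c (at_left 1) (phip j) (up k) (RtoC 0) /\
     is_sesq_form_lim n alpha beta c (at_right (-1)) (phim j) (um k) (RtoC 0)) /\
  is_sesq_form_lim n alpha beta c (at_left 1) (phip k) (up k) (RtoC 1) /\
  is_sesq_form_lim n alpha beta c (at_right (-1)) (phim k) (um k) (RtoC 1).
Proof.
intros n alpha beta Ha Hb c Hc phip vp phim vm Hp Hm up um Hup Hum.
assert (Hplus : forall j k, (1 <= j <= n)%nat -> (1 <= k <= n)%nat ->
  is_sesq_form_lim n alpha beta c (at_left 1) (phip j) (up k) (RtoC (delta j k))).
{ intros j k Hj Hk.
  assert (Hw : forall m x, -1 < x < 1 -> jacobi_a alpha beta c m x =
    c m * (Rpower (1 - 1 * x) (alpha + INR m) * Rpower (1 + 1 * x) (beta + INR m))).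
  { intros m x _. unfold jacobi_a, jacobi_weight. now rewrite Rmult_1_l. }
  assert (Hphi : forall i, (1 <= i <= n)%nat ->
    at_left 1 (fun x => phip i x = RtoC ((1 - 1 * x) ^ (i - 1)))).
  { intros i Hi. destruct (Hp i Hi) as [_ [_ [H _]]]. revert H.
    apply filter_imp. intros x ->. now rewrite Rmult_1_l. }
  apply (has_boundary_values_lim n 1 alpha beta c (at_left 1) alpha beta _ _
           (fun j => delta j k) j endpoint_at_left Hw Hj (Hphi j Hj)).
  apply (recursive_family_boundary_values n 1 alpha beta c (at_left 1) alpha beta
           phip vp up endpoint_at_left Ha); try assumption.
  - apply (lagrange_coefficient_top n alpha beta c Ha); [lia | exact Hc].
  - intros i Hi. destruct (Hp i Hi) as [_ [_ [_ [H _]]]]. revert H.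
    apply filter_imp. intros x ->. now rewrite Rmult_1_l. }
assert (Hminus : forall j k, (1 <= j <= n)%nat -> (1 <= k <= n)%nat ->
  is_sesq_form_lim n alpha beta c (at_right (-1)) (phim j) (um k) (RtoC (delta j k))).
{ intros j k Hj Hk.
  assert (Et : forall x, 1 - -1 * x = 1 + x) by (intros x; ring).
  (* At -1 the exponents change places: [beta] now belongs to the factor that vanishes at the
     endpoint. *)
  assert (Hw : forall m x, -1 < x < 1 -> jacobi_a alpha beta c m x =
    c m * (Rpower (1 - -1 * x) (beta + INR m) * Rpower (1 + -1 * x) (alpha + INR m))).
  { intros m x _. unfold jacobi_a, jacobi_weight. rewrite Et.
    replace (1 + -1 * x) with (1 - x) by ring. ring. }
  assert (Hphi : forall i, (1 <= i <= n)%nat ->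
    at_right (-1) (fun x => phim i x = RtoC ((1 - -1 * x) ^ (i - 1)))).
  { intros i Hi. destruct (Hm i Hi) as [_ [_ [H _]]]. revert H.
    apply filter_imp. intros x ->. now rewrite Et. }
  apply (has_boundary_values_lim n (-1) beta alpha c (at_right (-1)) alpha beta _ _
           (fun j => delta j k) j endpoint_at_right Hw Hj (Hphi j Hj)).
  apply (recursive_family_boundary_values n (-1) beta alpha c (at_right (-1)) alpha beta
           phim vm um endpoint_at_right Hb); try assumption.
  - apply (lagrange_coefficient_top n alpha beta c Ha); [lia | exact Hc].
  - intros i Hi. destruct (Hm i Hi) as [_ [_ [_ [H _]]]]. revert H.
    apply filter_imp. intros x ->. now rewrite Et. }
intros j k Hj Hk.
assert (Hjk : j <> k -> delta j k = 0).
{ intros H. unfold delta. now destruct (Nat.eqb_spec j k). }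
assert (Hkk : delta k k = 1) by (unfold delta; now rewrite Nat.eqb_refl).
assert (H1 := Hplus k k Hk Hk). assert (H2 := Hminus k k Hk Hk).
assert (H3 := Hplus j k Hj Hk). assert (H4 := Hminus j k Hj Hk).
rewrite Hkk in H1, H2.
split; [|now split]. intros H. rewrite (Hjk H) in H3, H4. now split.
Qed.
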